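(* Let $\mathcal{B}$ be a collection of undirected graphs and let $\epsilon<2$ be a real number such that $\mathrm{ex}(n,\mathcal{B})=\Theta(n^{2-\epsilon})$. Then there is a constant $C=C(\mathcal{B})>0$ such that for all positive integers $n$ there exists a digraph $G$ on $n$ vertices with $m=\mathrm{ex}(n,\mathcal{B})$ edges such that $\overline{G}$ is $\mathcal{B}$-free and $$\beta(G)\ge \frac{m}{2}-C\,m^{\frac34+\frac{\epsilon}{4(2-\epsilon)}}.$$
   Context: All digraphs are finite and oriented: no loops, no parallel edges, no antiparallel edges. The underlying undirected graph $\overline{G}$ is obtained by replacing each directed edge by an undirected edge. An undirected graph is $\mathcal{B}$-free if it contains no member of $\mathcal{B}$ as a (not necessarily induced) subgraph. The extremal number $\mathrm{ex}(n,\mathcal{B})$ is the maximum number of edges of a $\mathcal{B}$-free undirected (simple) graph on $n$ vertices; $\Theta$ is as $n\to\infty$. A feedback arc set of $G=(V,E)$ is a set $S\subset E$ such that $(V,E\setminus S)$ has no directed cycles; $\beta(G)$ is the minimum size of a feedback arc set. The exponent $\epsilon$ is a fixed number associated with $\mathcal{B}$. *)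

(* Defs.v *)
From HB Require Import structures.
From mathcomp Require Import all_boot.
From mathcomp Require Import all_classical all_reals all_analysis.

Set Implicit Arguments.
Unset Strict Implicit.
Unset Printing Implicit Defensive.

Record sgraph (V : finType) := SGraph {
  edges : {set {set V}};
  edges_card2 : [forall e in edges, #|e| == 2] }.

HB.instance Definition _ (V : finType) := [isSub for @edges V].
HB.instance Definition _ (V : finType) := [Finite of sgraph V by <:].

Definition graph_family := forall W : finType, sgraph W -> Prop.

Definition has_subgraph (V W : finType) (G : sgraph V) (H : sgraph W) : Prop :=
  exists2 f : W -> V, injective f & forall e, e \in edges H -> f @: e \in edges G.

Definition family_free (B : graph_family) (V : finType) (G : sgraph V) : Prop :=
  forall (W : finType) (H : sgraph W), B W H -> ~ has_subgraph G H.

(* The maximum over no graphs is 0; this case occurs only if some member of B has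
   no edges, and then also for all larger n. *)
Definition extremal_number (B : graph_family) (n : nat) : nat :=
  \max_(G : sgraph 'I_n | `[< family_free B G >]) #|edges G|.

(* The case x = y of the condition excludes loops. *)
Record digraph (V : finType) := Digraph {
  arcs : {set V * V};
  arcs_oriented : forall x y, (x, y) \in arcs -> (y, x) \notin arcs }.

Lemma underlying_subproof (V : finType) (G : digraph V) :
  [forall e in [set [set a.1; a.2] | a in arcs G], #|e| == 2].
Proof.
apply/forall_inP => _ /imsetP[[x y] xyG ->] /=.
rewrite cards2; case: (eqVneq x y) => // eq_xy; rewrite eq_xy in xyG.
by have := arcs_oriented xyG; rewrite xyG.
Qed.

Definition underlying (V : finType) (G : digraph V) : sgraph V :=
  SGraph (underlying_subproof G).

Definition acyclic (V : finType) (A : {set V * V}) : Prop :=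
  forall c : seq V, c != [::] -> uniq c -> ~~ cycle (fun x y => (x, y) \in A) c.

Definition feedback_arc_set (V : finType) (G : digraph V) (S : {set V * V}) :
  Prop := S \subset arcs G /\ acyclic (arcs G :\: S).

(* The default value #|arcs G| of the minimum is attained by S = arcs G. *)
Definition min_fas (V : finType) (G : digraph V) : nat :=
  \big[minn/#|arcs G|]_(S : {set V * V} | `[< feedback_arc_set G S >]) #|S|.

(* Main.v *)
Require Import Defs.
From mathcomp Require Import all_boot all_order all_algebra.
From mathcomp Require Import all_classical all_reals all_analysis.
From mathcomp Require Import ring lra zify.
Import Order.TTheory GRing.Theory Num.Theory.
Import numFieldNormedType.Exports.

Set Implicit Arguments.
Unset Strict Implicit.
Unset Printing Implicit Defensive.

Local Open Scope ring_scope.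

(** Take an extremal graph on [n] vertices and orient every edge at random.  If
    [S] is a feedback arc set, the remaining arcs are increasing for some linear
    order [r], so [S] contains all arcs that decrease along [r]
    ([min_fas_back_arcs]).  It is therefore enough that for one orientation and
    all [r] at once, the increasing arcs outnumber the decreasing ones by at
    most [O(sqrt (m n))]; this is the error term of the theorem, because [n] is
    of order [m `^ (1 / (2 - eps))].

    A union bound over the [n!] linear orders would lose a factor
    [sqrt (ln n)].  It is avoided by a dyadic decomposition.  Embed the order in
    [0, 2 ^ k) with [2 ^ k <= 2 n], and charge every pair of vertices to the
    unique level [j] at which the two enter different halves of a common block
    of length [2 ^ (k - j)] ([cmp_sign_dyadic]).  What happens at level [j]
    depends only on a map from the vertices to [2 ^ j.+1] blocks, so there are
    only [2 ^ (j.+1 * n)] events to exclude, and only edges inside blocks of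
    size at most [2 ^ (k - j)] are concerned.  Subgraphs of the extremal graph
    are free as well, hence the number of those edges is at most of order
    [n * (n / 2 ^ j) `^ (1 - eps)] ([mono_pairs_le]).  For [eps < 1] this decays
    geometrically in [j].  Up to a factor linear in [j], the deviation at level
    [j] is [sqrt (n * number of those edges)], and the sum over the levels is
    [O(sqrt (m n))] ([orient_low_discrepancy_powR]).

    The random orientation enters through exponential moments: a sum over
    orientations of a weighted family of exponentials which is small on average
    is small for some orientation ([exists_signs]).

    For [1 <= eps] the exponent of [m] is at least 1 and the inequality is
    trivial.  The hypothesis on the growth of the extremal number is also what
    makes free graphs exist for every [n]: if some member of the family had no
    edges, the extremal number would vanish from some point on
    ([extremal_number_eq0]). *)

(** * Random signs *)

(** The constant 2 in the exponent, instead of the optimal 1/2, allows a proof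
    from [1 + x <= expR x] alone: for small [y] it gives
    [expR y <= 1 / (1 - y)], and for large [y] the linear exponent is absorbed
    by the quadratic one. *)
Lemma cosh_subgaussian (R : realType) (y : R) :
  expR y + expR (- y) <= 2 * expR (2 * y ^+ 2).
Proof.
case: (lerP (1 / 2) `|y|) => hy.
- have le_exp (z : R) : `|z| = `|y| -> expR z <= expR (2 * y ^+ 2).
    move=> hz; rewrite ler_expR (le_trans (ler_norm z)) // hz.
    rewrite -real_normK ?num_real//; nra.
  have := le_exp y erefl; have := le_exp (- y) (normrN y); lra.
- have hy2 : y ^+ 2 < 1 / 4.
    by rewrite -real_normK ?num_real//; have := normr_ge0 y; nra.
  have /andP[hy1 hy3] : - (1 / 2) < y < 1 / 2 by rewrite -ltr_norml.
  have exp_inv (z : R) : expR z * (1 - z) <= 1.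
    have := expR_ge1Dx (- z); have := expR_gt0 z.
    have : expR z * expR (- z) = 1 by rewrite -expRD subrr expR0.
    nra.
  have h1 := exp_inv y; have h2 := exp_inv (- y).
  have h3 := expR_ge1Dx (2 * y ^+ 2).
  have : (expR y + expR (- y)) * (1 - y ^+ 2) <= 2 by nra.
  set a := expR y + expR (- y) => ha.
  have a_gt0 : 0 < a by rewrite addr_gt0 ?expR_gt0.
  have q_ge0 := sqr_ge0 y.
  have : 0 <= (2 - a * (1 - y ^+ 2)) * (1 + 2 * y ^+ 2).
    by rewrite mulr_ge0 ?subr_ge0 //; lra.
  have : 0 <= a * (y ^+ 2 * (1 - 2 * y ^+ 2))
    by apply: (mulr_ge0 (ltW a_gt0)); apply: (mulr_ge0 q_ge0); lra.
  lra.
Qed.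

(** The moment generating function of a random signed sum: independence of the
    signs turns the average of the exponential into a product of hyperbolic
    cosines. *)
Lemma sum_signs_expR (R : realType) (E : finType) (x : E -> R) :
  \sum_(s : {ffun E -> bool}) expR (\sum_e (-1) ^+ s e * x e)
  <= #|{ffun E -> bool}|%:R * expR (2 * \sum_e x e ^+ 2).
Proof.
have -> : \sum_(s : {ffun E -> bool}) expR (\sum_e (-1) ^+ s e * x e)
    = \prod_e \sum_(b : bool) expR ((-1) ^+ b * x e).
  by rewrite bigA_distr_bigA; apply: eq_bigr => s _; rewrite expR_sum.
rewrite card_ffun card_bool natrX -prodr_const mulr_sumr expR_sum -big_split /=.
apply: ler_prod => e _; rewrite big_bool expr0 expr1 mulN1r mul1r.
by rewrite addr_ge0 ?expR_ge0 //= addrC cosh_subgaussian.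
Qed.

(** Chernoff bound with a union bound over [I], in averaged form.  The potential
    [phi] sums one exponential per test; its mean is less than 1, so it is less
    than 1 for some signs, and then each of its positive terms is. *)
Lemma exists_signs (R : realType) (E I : finType) (P : pred I)
    (x : I -> E -> R) (lam t d : I -> R) :
  (forall a, P a -> 0 < lam a) ->
  (forall a, P a -> \sum_e x a e ^+ 2 <= d a) ->
  \sum_(a | P a) expR (2 * lam a ^+ 2 * d a - lam a * t a) < 1 ->
  exists s : {ffun E -> bool},
    forall a, P a -> \sum_e (-1) ^+ s e * x a e < t a.
Proof.
move=> lam_gt0 xd w_lt1.
pose phi (s : {ffun E -> bool}) :=
  \sum_(a | P a) expR (lam a * (\sum_e (-1) ^+ s e * x a e) - lam a * t a).
have [s phi_lt1] : exists s, phi s < 1.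
  apply/not_existsP => phi_ge1.
  suff: \sum_s phi s < \sum_(s : {ffun E -> bool}) 1.
    apply/negP; rewrite -leNgt; apply: ler_sum => s _.
    by rewrite leNgt; apply/negP/phi_ge1.
  rewrite sumr_const -[1 *+ _]mulr1 exchange_big /=.
  apply: le_lt_trans (_ : #|{ffun E -> bool}|%:R *
    \sum_(a | P a) expR (2 * lam a ^+ 2 * d a - lam a * t a) < _); last first.
    rewrite ltr_pM2l // ltr0n card_ffun card_bool.
    by rewrite expn_gt0.
  rewrite mulr_sumr; apply: ler_sum => a Pa.
  under eq_bigr do rewrite expRD.
  rewrite -mulr_suml expRD mulrA ler_wpM2r ?expR_ge0 //.
  have -> : \sum_(s : {ffun E -> bool})
      expR (lam a * (\sum_e (-1) ^+ s e * x a e))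
    = \sum_(s : {ffun E -> bool})
      expR (\sum_e (-1) ^+ s e * (lam a * x a e)).
    apply: eq_bigr => s _; rewrite mulr_sumr; congr expR.
    by apply: eq_bigr => e _; rewrite mulrCA.
  apply: le_trans (sum_signs_expR _) _.
  rewrite ler_wpM2l // ler_expR -mulrA ler_wpM2l //.
  under eq_bigr do rewrite exprMn.
  by rewrite -mulr_sumr ler_wpM2l ?sqr_ge0 // xd.
exists s => a Pa; rewrite -(ltr_pM2l (lam_gt0 a Pa)) -subr_lt0 -expR_lt1.
apply: le_lt_trans phi_lt1; rewrite /phi (bigD1 a) //= lerDl.
by apply: sumr_ge0 => b _; exact: expR_ge0.
Qed.

(** * Extremal graphs *)

Lemma edge_card2 (V : finType) (G : sgraph V) e : e \in edges G -> #|e| = 2%N.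
Proof. by move=> eG; apply/eqP; exact: (forall_inP (edges_card2 G)). Qed.

Lemma edgeless_subproof (V : finType) :
  [forall e in @finset.set0 {set V}, #|e| == 2%N].
Proof. by apply/forall_inP => e; rewrite inE. Qed.

Definition edgeless (V : finType) : sgraph V := SGraph (edgeless_subproof V).

Lemma extremal_number_attained (B : graph_family) (n : nat) :
  family_free B (edgeless 'I_n) ->
  exists2 G : sgraph 'I_n,
    family_free B G & #|edges G| = extremal_number B n.
Proof.
move=> free0.
have [|G GB exG] := @eq_bigmax_cond (sgraph 'I_n)
  [pred G | `[< family_free B G >]] (fun G => #|edges G|).
  by apply/card_gt0P; exists (edgeless 'I_n); exact/asboolP.
exists G; first exact/asboolP.
by rewrite /extremal_number; rewrite -exG; apply: eq_bigl => H; rewrite inE.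
Qed.

(** A graph without edges fails to be free only if it contains an edgeless
    member of the family, and that member embeds in all larger graphs. *)
Lemma extremal_number_eq0 (B : graph_family) (n n' : nat) :
  ~ family_free B (edgeless 'I_n) -> (n <= n')%N -> extremal_number B n' = 0%N.
Proof.
move=> not_free nn'; rewrite /extremal_number big_pred0 // => G.
apply/asboolP => freeG; apply: not_free => W H BH [f f_inj fH].
apply: (freeG W H BH); exists (fun w => widen_ord nn' (f w)).
  by move=> u v /(congr1 val) /= uv; apply: f_inj; exact: val_inj.
by move=> e /fH; rewrite inE.
Qed.

(** The condition on the cardinality matters because a non-injective [f] could
    send a larger set onto an edge. *)
Lemma pullback_subproof (U V : finType) (f : U -> V) (G : sgraph V) :
  [forall e in [set e : {set U} | (#|e| == 2%N) && (f @: e \in edges G)]%SET,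
     #|e| == 2%N].
Proof. by apply/forall_inP => e; rewrite inE => /andP[]. Qed.

Definition pullback (U V : finType) (f : U -> V) (G : sgraph V) : sgraph U :=
  SGraph (pullback_subproof f G).

Lemma pullback_free (B : graph_family) (U V : finType) (f : U -> V)
    (G : sgraph V) :
  injective f -> family_free B G -> family_free B (pullback f G).
Proof.
move=> f_inj freeG W H BH [g g_inj gH]; apply: (freeG W H BH).
exists (f \o g); first exact: inj_comp.
by move=> e /gH; rewrite inE imset_comp => /andP[].
Qed.

(** The subgraph induced on [A], transported to an ordinal, is free. *)
Lemma edges_within_le (B : graph_family) (V : finType) (G : sgraph V)
    (A : {set V}) :
  family_free B G ->
  (#|[set e in edges G | e \subset A]%SET| <= extremal_number B #|A|)%N.
Proof.
move=> freeG; set f := @enum_val V (mem A).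
have f_inj : injective f by exact: enum_val_inj.
apply: leq_trans (_ : #|edges (pullback f G)| <= _)%N; last first.
  apply: (@leq_bigmax_cond _ (fun H => `[< family_free B H >])
    (fun H : sgraph 'I_#|A| => #|edges H|)).
  exact/asboolP/pullback_free.
apply: leq_trans (leq_imset_card (fun e : {set 'I_#|A|} => f @: e) _).
apply/subset_leq_card/fintype.subsetP => e; rewrite inE => /andP[eG eA].
have fe : f @: (f @^-1: e) = e.
  apply/setP => v; apply/imsetP/idP => [[i + ->]|ve]; first by rewrite inE.
  have vA : v \in A by exact: (fintype.subsetP eA).
  exists (enum_rank_in vA v); last by rewrite /f enum_rankK_in.
  by rewrite inE /f enum_rankK_in.
apply/imsetP; exists (f @^-1: e) => //.
by rewrite inE fe eG andbT -(edge_card2 eG) -[in X in _ == X]fe card_imset.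
Qed.

(** * Orientations and linear orders *)

Lemma set2_arc (V : finType) (x y x' y' : V) :
  [set x; y]%SET = [set x'; y']%SET ->
  (x, y) = (x', y') \/ (x, y) = (y', x').
Proof.
move=> eq_xy.
have /set2P hx : x \in [set x'; y']%SET by rewrite -eq_xy finset.set21.
have /set2P hy : y \in [set x'; y']%SET by rewrite -eq_xy finset.set22.
have /set2P hx' : x' \in [set x; y]%SET by rewrite eq_xy finset.set21.
have /set2P hy' : y' \in [set x; y]%SET by rewrite eq_xy finset.set22.
by case: hx; case: hy; case: hx'; case: hy'; move=> *; subst; auto.
Qed.

Lemma card_underlying (V : finType) (D : digraph V) :
  #|edges (underlying D)| = #|arcs D|.
Proof.
apply: card_in_imset => -[x y] [x' y'] /= xyD xyD' /set2_arc[//|xy].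
by have := arcs_oriented xyD'; rewrite -xy xyD.
Qed.

(** The sign of the pair [(x, y)] with [x < y] decides the direction of the edge
    [{x, y}]; [true] reverses it, so that [(-1) ^+ s (x, y)] is the contribution
    of the edge to an antisymmetric sum over the arcs. *)
Lemma orient_subproof n (G : sgraph 'I_n) (s : {ffun 'I_n * 'I_n -> bool}) x y :
  let A := [set a : 'I_n * 'I_n | ([set a.1; a.2] \in edges G) &&
    (if (a.1 < a.2)%N then ~~ s a else s (a.2, a.1))]%SET in
  (x, y) \in A -> (y, x) \notin A.
Proof.
move=> A; rewrite {}/A !inE /= => /andP[xyG]; rewrite finset.setUC xyG /=.
case: (ltngtP x y) => [_ /negbTE->//|_ ->//|/val_inj xy].
by have := edge_card2 xyG; rewrite xy cards2 eqxx.
Qed.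

Definition orient n (G : sgraph 'I_n) (s : {ffun 'I_n * 'I_n -> bool}) :
  digraph 'I_n := Digraph (@orient_subproof n G s).

Lemma underlying_orient n (G : sgraph 'I_n) s : underlying (orient G s) = G.
Proof.
apply: val_inj; apply/setP => e; apply/imsetP/idP => [[[x y] + ->]|eG].
  by rewrite inE => /andP[].
have /eqP/cards2P[x [y [xy eE]]] := edge_card2 eG.
wlog ltxy : x y xy eE / (x < y)%N.
  move=> wl; case: (ltngtP x y) => [xy'|yx|/val_inj eqxy].
    exact: (wl x y xy eE xy').
    by apply: (wl y x) => //; rewrite 1?eq_sym // eE finset.setUC.
  by rewrite eqxy eqxx in xy.
case sxy : (s (x, y)); last first.
  by exists (x, y); rewrite ?inE //= -eE eG ltxy sxy.
exists (y, x); rewrite ?inE /= finset.setUC -?eE //.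
by rewrite eG ltnNge ltnW //= sxy.
Qed.

(** Sorting the vertices by the number of their ancestors: along an arc this
    number increases strictly, for otherwise the arc would close a cycle. *)
Lemma acyclic_rank (V : finType) (A : {set V * V}) : acyclic A ->
  exists r : V -> nat, [/\ injective r, forall v, (r v < #|V|)%N &
    forall x y, (x, y) \in A -> (r x < r y)%N].
Proof.
move=> acA; pose e : rel V := fun x y => (x, y) \in A.
pose h x := #|[set y | connect e y x]%SET|.
have h_lt x y : (x, y) \in A -> (h x < h y)%N.
  move=> xyA; apply/proper_card/properP; split.
    apply/fintype.subsetP => z; rewrite !inE => zx.
    exact: connect_trans zx (connect1 xyA).
  exists y; rewrite inE ?connect0 //.
  apply/negP => /connectP[p yp xp].
  move: xp; case: (shortenP yp) => p' yp' uniq_p' _ xp'.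
  have /negP[] := acA (y :: p') isT uniq_p'.
  by rewrite /= rcons_path yp' /= -xp'.
pose le_h : rel V := fun x y => (h x <= h y)%N.
have le_h_total : total le_h by move=> x y; exact: leq_total.
have le_h_trans : transitive le_h by move=> x y z; exact: leq_trans.
pose q := sort le_h (enum V).
have in_q x : x \in q by rewrite mem_sort mem_enum.
exists (fun v => index v q); split.
- by move=> x y; exact: index_inj.
- by move=> v; rewrite cardE -(size_sort le_h) index_mem.
- move=> x y /h_lt; rewrite !ltnNge; apply: contra => yx.
  have le_h_refl : reflexive le_h by move=> z; exact: leqnn.
  exact: (sorted_leq_index le_h_trans le_h_refl (sort_sorted le_h_total _)
    _ _ (in_q y) (in_q x) yx).
Qed.

Lemma min_fas_attained (V : finType) (D : digraph V) :
  exists2 S : {set V * V}, feedback_arc_set D S & min_fas D = #|S|.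
Proof.
rewrite /min_fas; elim/big_ind: _ => [|a b [S FS ->] [T FT ->]|S /asboolP FS].
- exists (arcs D) => //; split=> // -[//|x c] _ _ /=.
  rewrite finset.setDv; case: c => [|y c] /=; by rewrite inE.
- by case: (leqP #|S| #|T|) => _; [exists S | exists T].
- by exists S.
Qed.

Lemma min_fas_back_arcs (V : finType) (D : digraph V) :
  exists r : V -> nat, [/\ injective r, forall v, (r v < #|V|)%N &
    (#|[set a in arcs D | (r a.2 < r a.1)%N]%SET| <= min_fas D)%N].
Proof.
have [S [SD acS] ->] := min_fas_attained D.
have [r [r_inj r_lt rS]] := acyclic_rank acS.
exists r; split=> //; apply/subset_leq_card/fintype.subsetP => -[x y].
rewrite inE /= => /andP[xyD yx]; apply: contraLR yx => xyS.
by rewrite -leqNgt ltnW // rS // inE xyS.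
Qed.

(** * Dyadic decomposition of a linear order *)

Section Dyadic.
Variable R : realType.

Definition cmp_sign (a b : nat) : R := (a < b)%N%:R - (b < a)%N%:R.

Lemma cmp_signC a b : cmp_sign a b = - cmp_sign b a.
Proof. by rewrite /cmp_sign opprB. Qed.

Lemma cmp_sign_sqr_le1 a b : cmp_sign a b ^+ 2 <= 1.
Proof.
rewrite /cmp_sign.
by case: (ltngtP a b) => _; rewrite ?subr0 ?sub0r ?sqrrN expr2 ?mulr1 ?mulr0.
Qed.

(** Numbers with different halves compare like their halves. *)
Lemma cmp_sign_half a b :
  (if a./2 == b./2 then cmp_sign a b else 0) = cmp_sign a b - cmp_sign a./2 b./2.
Proof.
case: (eqVneq a./2 b./2) => [->|ab]; first by rewrite {3}/cmp_sign ltnn !subr0.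
suff -> : cmp_sign a b = cmp_sign a./2 b./2 by rewrite subrr.
rewrite /cmp_sign; congr (_%:R - _%:R); congr nat_of_bool; lia.
Qed.

(** By [cmp_sign_half] the sum telescopes: at level [j] the two numbers are
    compared through their leading [j.+1] binary digits out of [k], and only if
    the leading [j] digits agree. *)
Lemma cmp_sign_dyadic k a b : (a < 2 ^ k)%N -> (b < 2 ^ k)%N ->
  cmp_sign a b = \sum_(j < k)
    (if (a %/ 2 ^ (k - j.+1))./2 == (b %/ 2 ^ (k - j.+1))./2
     then cmp_sign (a %/ 2 ^ (k - j.+1)) (b %/ 2 ^ (k - j.+1)) else 0).
Proof.
move=> ak bk; rewrite (reindex_inj rev_ord_inj) /=.
pose g i := cmp_sign (a %/ 2 ^ i) (b %/ 2 ^ i).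
rewrite (eq_bigr (fun i : 'I_k => g i - g i.+1)) => [|i _]; last first.
  rewrite subnSK // subKn ?(ltnW (ltn_ord i)) // cmp_sign_half.
  by rewrite /g -!divn2 -!divnMA -expnSr.
have -> : \sum_(i < k) (g i - g i.+1) = g 0%N - g k.
  elim: k {ak bk} => [|k IHk]; first by rewrite big_ord0 subrr.
  by rewrite big_ord_recr /= IHk addrA subrK.
by rewrite /g expn0 !divn1 !divn_small // {3}/cmp_sign ltnn !subr0.
Qed.

Lemma sum_arcs_orient n (G : sgraph 'I_n) s (w : 'I_n -> 'I_n -> R) :
  (forall u v, w u v = - w v u) ->
  \sum_(a in arcs (orient G s)) w a.1 a.2 =
  \sum_(a : 'I_n * 'I_n | (a.1 < a.2)%N && ([set a.1; a.2]%SET \in edges G))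
    (-1) ^+ s a * w a.1 a.2.
Proof.
move=> wC.
(* The arcs that decrease in ['I_n] are exactly the reversed ones. *)
rewrite (bigID (fun a : 'I_n * 'I_n => (a.1 < a.2)%N)) /=.
rewrite [RHS](bigID (fun a => s a)) /= addrC; congr (_ + _); last first.
  apply: eq_big => -[x y] /=; last first.
    rewrite inE /= => /andP[/andP[_ +] xy]; rewrite xy => /negbTE->.
    by rewrite mul1r.
  by rewrite inE /=; case: (x < y)%N; rewrite /= ?andbF // andbT andbC.
have swap_inj : injective (fun a : 'I_n * 'I_n => (a.2, a.1)).
  by move=> [x y] [x' y'] [-> ->].
rewrite (reindex_inj swap_inj) /=.
apply: eq_big => -[x y] /=; last first.
  rewrite inE /= => /andP[/andP[_ +] /negbTE xy]; rewrite xy => ->.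
  by rewrite expr1 mulN1r wC.
rewrite inE /= [in X in X \in _]finset.setUC.
case xyG : ([set x; y]%SET \in edges G); last by rewrite andbF.
case: (ltngtP x y) => [||/val_inj xy]; rewrite ?andbF ?andbT //.
by have := edge_card2 xyG; rewrite xy cards2 eqxx.
Qed.

Lemma sum_cmp_sign_arcs (V : finType) (D : digraph V) (r : V -> nat) :
  injective r ->
  \sum_(a in arcs D) cmp_sign (r a.1) (r a.2) =
  #|arcs D|%:R - 2 * #|[set a in arcs D | (r a.2 < r a.1)%N]%SET|%:R.
Proof.
move=> r_inj; rewrite -!sum1_card !natr_sum.
rewrite [X in 2 * X](eq_bigl
  (fun a => (a \in arcs D) && (r a.2 < r a.1)%N)); last first.
  by move=> a; rewrite inE.
rewrite big_mkcondr /= mulr_sumr -sumrB; apply: eq_bigr => -[x y] xyD /=.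
rewrite /cmp_sign; case: (ltngtP (r x) (r y)) => [_|_|/r_inj xy]; last first.
- by move: (arcs_oriented xyD); rewrite xy in xyD *; rewrite xyD.
- by rewrite mulr1n mulr0n; lra.
- by rewrite mulr1n mulr0n; lra.
Qed.

Definition mono_pairs n (G : sgraph 'I_n) (b : 'I_n -> nat) :
    {set 'I_n * 'I_n} :=
  [set a : 'I_n * 'I_n | [&& (a.1 < a.2)%N, [set a.1; a.2] \in edges G &
    b a.1 == b a.2]]%SET.

(** Each fiber of [b] spans a free graph with at most [M] vertices, so a linear
    bound for the extremal number up to [M] can be summed over the fibers. *)
Lemma mono_pairs_le (B : graph_family) n (G : sgraph 'I_n) (b : 'I_n -> nat)
    (M : nat) (q : R) :
  family_free B G ->
  (forall l, #|[set v | b v == l]%SET| <= M)%N ->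
  (forall s, (s <= M)%N -> (extremal_number B s)%:R <= q * s%:R) ->
  #|mono_pairs G b|%:R <= q * n%:R.
Proof.
move=> freeG bM exM; pose N := \max_v b v.
pose p v : 'I_N.+1 := inord (b v).
have pE v (l : 'I_N.+1) : (p v == l) = (b v == l).
  by rewrite -val_eqE /= inordK // ltnS; exact: leq_bigmax.
rewrite -sum1_card (partition_big (fun a => p a.1) predT) //= natr_sum.
have -> : q * n%:R = \sum_(l < N.+1) q * #|[set v | b v == l]%SET|%:R.
  rewrite -mulr_sumr -natr_sum; congr (_ * _%:R).
  rewrite -[LHS]card_ord -sum1_card (partition_big p predT) //=.
  apply: eq_bigr => l _; rewrite -sum1_card.
  by apply: eq_bigl => v; rewrite inE pE.
apply: ler_sum => l _; apply: le_trans (exM _ (bM l)).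
rewrite ler_nat; apply: leq_trans (edges_within_le _ freeG).
pose e (a : 'I_n * 'I_n) := [set a.1; a.2]%SET.
rewrite (eq_bigl (mem [set a in mono_pairs G b | p a.1 == l]%SET)); last first.
  by move=> a; rewrite !inE.
rewrite sum1_card -(@card_in_imset _ _ e) => [|[x y] [x' y']]; last first.
  rewrite !inE /= => /andP[/andP[xy _] _] /andP[/andP[xy' _] _].
  by move=> /set2_arc[//|[xE yE]]; rewrite xE yE ltnNge ltnW in xy.
apply/subset_leq_card/fintype.subsetP => _ /imsetP[[x y] + ->].
rewrite !inE pE /= => /andP[/and3P[_ xyG /eqP xy] /eqP xl].
rewrite /e /= xyG /=; apply/fintype.subsetP => z.
by rewrite !inE => /orP[] /eqP->; rewrite -?xy xl.
Qed.

Lemma card_dyadic_fiber n (r : 'I_n -> nat) i l : injective r ->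
  (#|[set v | r v %/ 2 ^ i == l]%SET| <= 2 ^ i)%N.
Proof.
move=> r_inj; have i_gt0 : (0 < 2 ^ i)%N by rewrite expn_gt0.
(* On a fiber of the quotient, the remainder determines [r v]. *)
pose f v := Ordinal (ltn_pmod (r v) i_gt0).
rewrite -(@card_in_imset _ _ f); first by rewrite -[leqRHS]card_ord max_card.
move=> u v; rewrite !inE => /eqP ul /eqP vl /(congr1 val) /= uv.
by apply: r_inj; rewrite (divn_eq (r u) (2 ^ i)) ul uv -vl -divn_eq.
Qed.

Lemma expR_N3_le : expR (- 3) <= 1 / 4 :> R.
Proof.
have e3 : 4 <= expR 3 :> R by have := expR_ge1Dx (3 : R); lra.
have : expR (- 3) * expR 3 = 1 :> R by rewrite -expRD addNr expR0.
have := expR_gt0 (- 3 : R); nra.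
Qed.

(** The room for the union bound: [expR (- 3) <= 1 / 4] against a factor 2 for
    each of the [j.+1 * n] binary digits of a block map at level [j]. *)
Lemma dyadic_weight_lt1 n k : (0 < n)%N ->
  \sum_(j < k) #|{ffun 'I_n -> 'I_(2 ^ j.+1)}|%:R * expR (- (3 * j.+1%:R * n%:R))
    < 1 :> R.
Proof.
move=> n_gt0.
apply: (@le_lt_trans _ _ (\sum_(j < k) (1 / 2) ^+ j.+1)); last first.
  suff -> : \sum_(j < k) (1 / 2) ^+ j.+1 = 1 - (1 / 2) ^+ k :> R.
    by rewrite ltrBlDr ltrDl exprn_gt0.
  elim: k => [|k IHk]; first by rewrite big_ord0 expr0 subrr.
  by rewrite big_ord_recr /= IHk exprS; lra.
apply: ler_sum => j _.
have -> : - (3 * j.+1%:R * n%:R) = (j.+1 * n)%:R * (- 3) :> R.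
  by rewrite natrM; ring.
rewrite expRM_natl card_ffun !card_ord -expnM natrX -exprMn.
apply: (@le_trans _ _ ((1 / 2) ^+ (j.+1 * n))).
  apply: lerXn2r; rewrite ?nnegrE ?mulr_ge0 ?expR_ge0 //.
  have := expR_N3_le; lra.
apply: ler_wiXn2l; [lra|lra|by rewrite leq_pmulr].
Qed.

(** The number [lam j] is the free parameter of the exponential moment at level
    [j].  The two terms of the deviation allowed at that level come from the
    number of block maps and from the variance, which is at most [q j * n]. *)
Lemma orient_low_discrepancy (B : graph_family) n (G : sgraph 'I_n) k
    (q lam : nat -> R) :
  (0 < n <= 2 ^ k)%N -> family_free B G ->
  (forall j, 0 < lam j) ->
  (forall j s, (j < k)%N -> (s <= 2 ^ (k - j))%N ->
     (extremal_number B s)%:R <= q j * s%:R) ->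
  exists s, #|edges G|%:R
    - \sum_(j < k) (3 * j.+1%:R * n%:R / lam j + 2 * lam j * (q j * n%:R))
    <= 2 * (min_fas (orient G s))%:R :> R.
Proof.
move=> /andP[n_gt0 nk] freeG lam_gt0 exq.
pose I := {j : 'I_k & {ffun 'I_n -> 'I_(2 ^ j.+1)}}.
pose half (c : 'I_n -> nat) v := (c v)./2.
pose x (c : 'I_n -> nat) (a : 'I_n * 'I_n) : R :=
  if a \in mono_pairs G (half c) then cmp_sign (c a.1) (c a.2) else 0.
(* Only block maps with few edges inside blocks are tested; those that come
   from a linear order satisfy [P] by [mono_pairs_le]. *)
pose P (i : I) :=
  #|mono_pairs G (half (fun v => tagged i v))|%:R <= q (tag i) * n%:R.
pose t j := 3 * j.+1%:R * n%:R / lam j + 2 * lam j * (q j * n%:R).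
have [|||s hs] := @exists_signs R ('I_n * 'I_n)%type I P
  (fun i => x (fun v => tagged i v)) (fun i => lam (tag i))
  (fun i => t (tag i)) (fun i => q (tag i) * n%:R).
- by move=> i _.
- move=> i; apply: le_trans.
  rewrite -sum1_card natr_sum [leRHS]big_mkcond /=; apply: ler_sum => a _.
  by rewrite /x; case: ifP => _; rewrite ?cmp_sign_sqr_le1 // expr2 mulr0.
- apply: le_lt_trans (dyadic_weight_lt1 k n_gt0).
  under [leRHS]eq_bigr do rewrite mulr_natl -sumr_const.
  rewrite (sig_big_dep (fun=> true) (fun _ => predT)) /=.
  rewrite big_mkcond [leRHS]big_mkcond; apply: ler_sum => i _ /=.
  case: ifP => _; last by rewrite expR_ge0.
  rewrite ler_expR /t; set l := lam _.
  have l_neq0 : l != 0 by rewrite gt_eqF ?lam_gt0.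
  rewrite mulrDr [l * (_ / l)]mulrC divfK //; lra.
exists s; have [r [r_inj r_lt r_back]] := min_fas_back_arcs (orient G s).
rewrite card_ord in r_lt.
have : \sum_(a in arcs (orient G s)) cmp_sign (r a.1) (r a.2) <= \sum_(j < k) t j.
  rewrite (sum_arcs_orient _ _ (w := fun u v => cmp_sign (r u) (r v))); last first.
    by move=> u v; exact: cmp_signC.
  pose c (j : 'I_k) v := (r v %/ 2 ^ (k - j.+1))%N.
  rewrite (eq_bigr (fun a => \sum_(j < k) (-1) ^+ s a *
     (if half (c j) a.1 == half (c j) a.2
      then cmp_sign (c j a.1) (c j a.2) else 0)));
    last first.
    by move=> a _; rewrite -mulr_sumr -cmp_sign_dyadic // (leq_trans (r_lt _)).
  rewrite exchange_big /=; apply: ler_sum => j _.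
  have cj_lt v : (c j v < 2 ^ j.+1)%N.
    rewrite /c ltn_divLR ?expn_gt0 // -expnD subnKC //.
    exact: leq_trans (r_lt v) nk.
  pose cj : {ffun 'I_n -> 'I_(2 ^ j.+1)} := [ffun v => Ordinal (cj_lt v)].
  have cjE : (fun v => cj v : nat) = c j by apply: funext => v; rewrite ffunE.
  have := hs (Tagged _ cj); rewrite /P /= cjE => hj.
  apply: le_trans (ltW (hj _)); last first.
    apply: (mono_pairs_le (M := 2 ^ (k - j)) freeG) => [l|i]; last exact: exq.
    apply: leq_trans (card_dyadic_fiber (k - j) l r_inj).
    apply/subset_leq_card/fintype.subsetP => v; rewrite !inE /half /c.
    by rewrite -divn2 -divnMA -expnSr subnSK.
  rewrite big_mkcond /=; apply: ler_sum => a _.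
  rewrite /x inE; case: (_ < _)%N => /=; last by rewrite mulr0.
  by case: (_ \in _) => /=; last by rewrite mulr0.
rewrite sum_cmp_sign_arcs // -(card_underlying (orient G s)) underlying_orient.
move: r_back; rewrite -(ler_nat R); lra.
Qed.

End Dyadic.

(** * Growth of the extremal number and the exponent *)

Local Open Scope classical_set_scope.
Local Open Scope ring_scope.

Lemma extremal_number0 (B : graph_family) : extremal_number B 0 = 0%N.
Proof.
apply/eqP; rewrite -leqn0; apply/bigmax_leqP => G _; rewrite leqn0 cards_eq0.
apply/eqP/setP => e; rewrite inE; apply/negP => /edge_card2 e2.
by have := max_card (mem e); rewrite card_ord e2.
Qed.

(** The asymptotic hypothesis made uniform in [n].  The lower bound survives for
    small [n] only where the extremal number does not vanish. *)
Lemma extremal_number_bounds (R : realType) (B : graph_family) (a : R) :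
  0 < a ->
  (fun n : nat => (extremal_number B n)%:R : R^o) \is
    'Theta_\oo (fun n : nat => n%:R `^ a : R^o) ->
  exists q c : R, [/\ 0 < q, 0 < c,
    (forall n, (extremal_number B n)%:R <= q * n%:R `^ a),
    (forall n, (0 < extremal_number B n)%N ->
       n%:R `^ a <= c * (extremal_number B n)%:R) &
    (forall n, exists2 n', (n <= n')%N & (0 < extremal_number B n')%N)].
Proof.
move=> a_gt0 /asboolP[[k1 k2] /= /andP[k1_gt0 k2_gt0] [N _ exN]].
have exNN n : (N <= n)%N -> k1 * n%:R `^ a <= (extremal_number B n)%:R
    /\ (extremal_number B n)%:R <= k2 * n%:R `^ a.
  move=> /exN /=; rewrite !ger0_norm ?powR_ge0 ?ler0n //.
pose Q : R := \sum_(n < N) (extremal_number B n)%:R.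
have Q_ge0 : 0 <= Q by apply: sumr_ge0 => i _; exact: ler0n.
have NR_ge0 : 0 <= N%:R `^ a by exact: powR_ge0.
exists (k2 + Q), (k1^-1 + N%:R `^ a); split.
- lra.
- by rewrite ltr_pwDl ?invr_gt0.
- move=> n; rewrite mulrDl; case: (leqP N n) => [/exNN[_ exn]|nN].
    by rewrite (le_trans exn) // lerDl mulr_ge0 ?powR_ge0.
  case: n nN => [|n] nN.
    by rewrite extremal_number0 addr_ge0 // mulr_ge0 ?powR_ge0 ?(ltW k2_gt0).
  have n_ge1 : 1 <= n.+1%:R `^ a :> R.
    have n1 : 1 <= n.+1%:R :> R by rewrite ler1n.
    by have := ler_powR n1 (ltW a_gt0); rewrite powRr0.
  have exQ : (extremal_number B n.+1)%:R <= Q.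
    by rewrite /Q (bigD1 (Ordinal nN)) //= lerDl sumr_ge0.
  have : 0 <= k2 * n.+1%:R `^ a by rewrite mulr_ge0 ?powR_ge0 ?(ltW k2_gt0).
  have : 0 <= Q * (n.+1%:R `^ a - 1) by rewrite mulr_ge0 ?subr_ge0.
  lra.
- move=> n ex_gt0; rewrite mulrDl; case: (leqP N n) => [/exNN[exn _]|nN].
    rewrite -ler_pdivlMl // in exn.
    by rewrite (le_trans exn) // lerDl mulr_ge0 ?ler0n.
  have nN' : n%:R `^ a <= N%:R `^ a :> R.
    by apply: ge0_ler_powR; rewrite ?nnegrE ?ler0n ?ler_nat ?(ltW a_gt0) ?(ltnW nN).
  have : 0 <= k1^-1 * (extremal_number B n)%:R.
    by apply: mulr_ge0; rewrite ?ler0n // invr_ge0 ltW.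
  have : N%:R `^ a <= N%:R `^ a * (extremal_number B n)%:R.
    by rewrite ler_peMr // ler1n.
  lra.
- move=> n; exists (maxn n (maxn N 1)); first exact: leq_maxl.
  have [|+ _] := exNN (maxn n (maxn N 1)); first by rewrite !leq_max leqnn orbT.
  rewrite -(ltr0n R); apply: lt_le_trans; rewrite mulr_gt0 // powR_gt0 // ltr0n.
Qed.

(** The right-hand side is the sum of the infinite series. *)
Lemma sum_arith_geom (R : realFieldType) (s : R) k : 0 <= s < 1 ->
  \sum_(j < k) j.+1%:R * s ^+ j <= (1 - s) ^- 2.
Proof.
move=> /andP[s_ge0 s_lt1]; rewrite -[_ ^- 2]mul1r ler_pdivlMr; last first.
  by rewrite exprn_gt0 // subr_gt0.
have -> : (\sum_(j < k) j.+1%:R * s ^+ j) * (1 - s) ^+ 2 =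
    1 - k.+1%:R * s ^+ k + k%:R * s ^+ k.+1.
  elim: k => [|k IHk]; first by rewrite big_ord0 expr0; ring.
  rewrite big_ord_recr /= mulrDl IHk -[k.+2%:R]natr1 -!natr1 !exprS; ring.
rewrite -natr1 exprS.
have sk_ge0 : 0 <= s ^+ k by exact: exprn_ge0.
have k_ge0 : 0 <= k%:R :> R by [].
have : 0 <= k%:R * s ^+ k * (1 - s) by rewrite !mulr_ge0 // subr_ge0 ltW.
nra.
Qed.

(** Here [S ^+ j] and [N] are the square roots of [2 `^ (- j * d)] and
    [n%:R `^ d].  With [lam j] the inverse of [N * S ^+ j] both terms of the
    deviation at level [j] are of order [n * N * j.+1 * S ^+ j]; this balances
    the entropy against the variance up to a factor linear in [j], and the
    sum over [j] is bounded. *)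
Lemma orient_low_discrepancy_powR (R : realType) (B : graph_family) (a q : R) :
  1 < a -> 0 < q ->
  (forall n, (extremal_number B n)%:R <= q * n%:R `^ a) ->
  exists2 T : R, 0 < T & forall n (G : sgraph 'I_n),
    (0 < n)%N -> family_free B G ->
    exists s, #|edges G|%:R - T * n%:R `^ ((1 + a) / 2)
              <= 2 * (min_fas (orient G s))%:R.
Proof.
move=> a_gt1 q_gt0 exq; pose d := a - 1.
have d_gt0 : 0 < d by rewrite subr_gt0.
pose S : R := (1 / 2) `^ (d / 2).
have S_gt0 : 0 < S by rewrite powR_gt0; lra.
have S_lt1 : S < 1.
  have := @gt0_ltr_powR R (d / 2) _ (1 / 2) 1.
  by rewrite powR1 /S; apply; rewrite ?inE ?nnegrE; lra.
have S2 : (1 / 2) `^ d = S ^+ 2.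
  by rewrite /S -powR_mulrn ?powR_ge0 // -powRrM divfK.
have p2_gt0 : 0 < 2 `^ d :> R by exact: powR_gt0.
pose T := (3 + 2 * q * 2 `^ d) * (1 - S) ^- 2.
have cT_gt0 : 0 < 3 + 2 * q * 2 `^ d by rewrite addr_gt0 // !mulr_gt0.
exists T; first by rewrite mulr_gt0 // invr_gt0 exprn_gt0 // subr_gt0.
move=> n G n_gt0 freeG.
have nR_gt0 : 0 < n%:R :> R by rewrite ltr0n.
pose N : R := n%:R `^ (d / 2).
have N_gt0 : 0 < N by exact: powR_gt0.
have NE : n%:R `^ ((1 + a) / 2) = n%:R * N.
  rewrite -{2}(powRr1 (ltW nR_gt0)) -powRD; last by rewrite (gt_eqF nR_gt0) implybT.
  by congr (_ `^ _); rewrite /d; field.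
have N2 : n%:R `^ d = N ^+ 2.
  by rewrite /N -powR_mulrn ?powR_ge0 // -powRrM divfK.
have /andP[kn nk] := trunc_log_bounds (isT : (1 < 2)%N) n_gt0.
set k := (trunc_log 2 n).+1 in nk.
have k2n : (2 ^ k <= 2 * n)%N by rewrite expnS leq_mul2l kn.
pose qj j := q * (2 `^ d * N ^+ 2 * (S ^+ j) ^+ 2).
pose lam j := (N * S ^+ j)^-1.
have NS_gt0 j : 0 < N * S ^+ j by rewrite mulr_gt0 // exprn_gt0.
have [||j s jk sk|s hs] := @orient_low_discrepancy R B n G k qj lam _ freeG.
- by rewrite n_gt0 ltnW.
- by move=> j; rewrite invr_gt0.
- apply: le_trans (exq s) _; rewrite /qj -mulrA ler_pM2l //.
  rewrite -mulr_powRB1 ?ler0n // -/d; last lra.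
  rewrite mulrC ler_wpM2r //.
  have -> : 2 `^ d * N ^+ 2 * (S ^+ j) ^+ 2 = (2 * n%:R * (1 / 2) ^+ j) `^ d.
    rewrite powRM ?exprn_ge0 ?mulr_ge0 ?divr_ge0 // powRM //.
    rewrite N2 -[(1 / 2) ^+ j]powR_mulrn ?divr_ge0 // powRAC.
    rewrite powR_mulrn ?powR_ge0 // S2.
    by rewrite -!exprM mulnC.
  apply: ge0_ler_powR; rewrite ?nnegrE ?(ltW d_gt0) ?mulr_ge0
    ?exprn_ge0 ?divr_ge0 //.
  apply: (@le_trans _ _ (2 ^ (k - j))%:R); first by rewrite ler_nat.
  rewrite mul1r exprVn ler_pdivlMr ?exprn_gt0 //.
  by rewrite -natrX -!natrM ler_nat -expnD subnK // ltnW.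
exists s; apply: le_trans hs; rewrite lerD2l lerN2 NE.
have term (j : 'I_k) :
    3 * j.+1%:R * n%:R / lam j + 2 * lam j * (qj j * n%:R)
    <= (3 + 2 * q * 2 `^ d) * (n%:R * N) * (j.+1%:R * S ^+ j).
  have -> : 3 * j.+1%:R * n%:R / lam j + 2 * lam j * (qj j * n%:R)
      = (3 * j.+1%:R + 2 * q * 2 `^ d) * (n%:R * N * S ^+ j).
    have Sj_neq0 : S ^+ j != 0 by rewrite gt_eqF // exprn_gt0.
    have N_neq0 : N != 0 by rewrite gt_eqF.
    by rewrite /lam /qj; field; rewrite Sj_neq0 N_neq0.
  rewrite [leRHS](_ : _ = (3 + 2 * q * 2 `^ d) * j.+1%:R * (n%:R * N * S ^+ j));
    last by ring.
  apply: ler_wpM2r; first by rewrite !mulr_ge0 ?exprn_ge0 ?(ltW S_gt0) ?(ltW N_gt0).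
  have : 0 <= 2 * q * 2 `^ d by rewrite !mulr_ge0 ?(ltW q_gt0) ?(ltW p2_gt0).
  have : 1 <= j.+1%:R :> R by rewrite ler1n.
  nra.
apply: le_trans (ler_sum _ (fun j _ => term j)) _.
rewrite -mulr_sumr /T -[leRHS]mulrA [_ ^- 2 * _]mulrC [leRHS]mulrA.
rewrite ler_wpM2l ?mulr_ge0 ?(ltW cT_gt0) ?(ltW N_gt0) //.
by apply: sum_arith_geom; rewrite (ltW S_gt0).
Qed.

(** * Feedback arc sets of oriented extremal graphs *)

Theorem theorem1p5 (R : realType) (B : graph_family) (eps : R)
    (eps_lt2 : eps < 2)
    (exB : (fun n : nat => (extremal_number B n)%:R : R^o) \is
             'Theta_\oo (fun n : nat => n%:R `^ (2 - eps) : R^o)) :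
  exists2 C : R, 0 < C &
    forall n : nat, (0 < n)%N ->
      exists G : digraph 'I_n,
        [/\ #|arcs G| = extremal_number B n,
            family_free B (underlying G) &
            (extremal_number B n)%:R / 2
              - C * (extremal_number B n)%:R `^ (3 / 4 + eps / (4 * (2 - eps)))
            <= (min_fas G)%:R].
Proof.
have a_gt0 : 0 < 2 - eps by rewrite subr_gt0.
have [q [c [q_gt0 c_gt0 exq exc ex_unbounded]]] :=
  extremal_number_bounds a_gt0 exB.
have attained n : exists2 G : sgraph 'I_n,
    family_free B G & #|edges G| = extremal_number B n.
  apply: extremal_number_attained; apply: contrapT => not_free.
  have [n' nn'] := ex_unbounded n.
  by rewrite (extremal_number_eq0 not_free nn').
have oriented n (G : sgraph 'I_n) s : family_free B G ->
    #|edges G| = extremal_number B n ->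
    #|arcs (orient G s)| = extremal_number B n /\
    family_free B (underlying (orient G s)).
  by move=> freeG exG; rewrite -card_underlying underlying_orient.
have pE : 3 / 4 + eps / (4 * (2 - eps)) = (2 - eps)^-1 * ((1 + (2 - eps)) / 2).
  by field; rewrite gt_eqF.
set p := 3 / 4 + _ in pE *.
case: (lerP 1 eps) => eps1.
  exists 1 => // n n_gt0; have [G freeG exG] := attained n.
  exists (orient G [ffun=> false]).
  have [arcsE freeE] := oriented n G [ffun=> false] freeG exG; split=> //.
  apply: le_trans (ler0n _ _); rewrite mul1r subr_le0.
  have p_ge1 : 1 <= p.
    rewrite pE -ler_pdivrMl ?invr_gt0 // invrK mulr1; lra.
  case: (posnP (extremal_number B n)) => [->|m_gt0].
    by rewrite mul0r powR_ge0.
  have : (extremal_number B n)%:R <= (extremal_number B n)%:R `^ p :> R.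
    by apply: le1r_powR => //; rewrite ler1n.
  have : 0 <= (extremal_number B n)%:R :> R by [].
  lra.
have a_gt1 : 1 < 2 - eps by lra.
have [T T_gt0 discrepancy] := orient_low_discrepancy_powR a_gt1 q_gt0 exq.
have cp_gt0 : 0 < c `^ p by exact: powR_gt0.
exists (T * c `^ p) => [|n n_gt0]; first exact: mulr_gt0.
have [G freeG exG] := attained n.
have [s hs] := discrepancy n G n_gt0 freeG.
exists (orient G s).
have [arcsE freeE] := oriented n G s freeG exG; split=> //.
case: (posnP (extremal_number B n)) => [->|m_gt0].
  rewrite mul0r sub0r; apply: le_trans (ler0n _ _).
  by rewrite oppr_le0 !mulr_ge0 ?powR_ge0 // ltW.
rewrite exG in hs; set m := (extremal_number B n)%:R in hs *.
have : n%:R `^ ((1 + (2 - eps)) / 2) <= c `^ p * m `^ p.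
  rewrite -powRM ?ler0n ?(ltW c_gt0) //.
  have -> : (1 + (2 - eps)) / 2 = (2 - eps) * p by rewrite pE mulVKf ?gt_eqF.
  rewrite powRrM; apply: ge0_ler_powR; rewrite ?nnegrE ?powR_ge0 ?exc //.
    by rewrite pE !mulr_ge0 ?invr_ge0 //; lra.
  by rewrite mulr_ge0 ?ler0n ?(ltW c_gt0).
move=> /(ler_wpM2l (ltW T_gt0)).
have : 0 <= T * (c `^ p * m `^ p) by rewrite !mulr_ge0 ?powR_ge0 // ltW.
rewrite -mulrA; lra.
Qed.
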